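(* Let $p\in[1,+\infty]$. Let $\theta_1,\theta_2\in[0,1)$ be such that $\theta_1-\theta_2\notin\mathbb{Q}$ and let $\Lambda,\Lambda'\subset\mathbb{N}$. If $\Lambda$ and $\Lambda'$ are $[-1,1]$-Müntz-Szász sequences, then the system $$\{\cos^\lambda 2\pi(t-\theta_1):\lambda\in\Lambda\}\cup\{\cos^{\lambda'}2\pi(t-\theta_2):\lambda'\in\Lambda'\}$$ is total in $X_p(0,1)$.
   Context: $\mathbb{N}=\{0,1,2,\ldots\}$. Functions on $[0,1]$ are identified with $1$-periodic functions on $\mathbb{R}$. $X_p(0,1)=L^p(0,1)$ if $1\le p<+\infty$, and $X_\infty(0,1)$ is the space of continuous $1$-periodic functions with the sup norm. A family is total in a normed space if its linear span is dense. A set $\Lambda\subset\mathbb{N}$ is a $[-1,1]$-Müntz-Szász sequence if $0\in\Lambda$, $\sum_{\lambda\in\Lambda,\ \lambda\text{ even},\ \lambda\neq0}\frac1\lambda=+\infty$ and $\sum_{\lambda\in\Lambda,\ \lambda\text{ odd}}\frac1\lambda=+\infty$. *)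

(* Defs.v *)
From mathcomp Require Import all_boot all_order all_algebra.
From mathcomp Require Import all_classical all_reals all_analysis.
From mathcomp Require Export complex.
Import Order.TTheory GRing.Theory Num.Theory.
Import numFieldNormedType.Exports.

Set Implicit Arguments.
Unset Strict Implicit.
Unset Printing Implicit Defensive.

Local Open Scope classical_set_scope.
Local Open Scope ring_scope.
Local Open Scope complex_scope.

Definition modulus (R : realType) (f : R -> R[i]) : R -> R :=
  fun t => Normc.normc (f t).

(* Scalars are complex.  For finite p an element of L^p(0,1) is represented by
   any function on R measurable on ]0, 1[: its values outside ]0, 1[ are
   irrelevant, since the norm is that of its extension by zero. *)
Definition Xnorm (R : realType) (p : \bar R) (f : R -> R[i]) : \bar R :=
  if p == +oo%E then ereal_sup (range (EFin \o modulus f))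
  else ('N[@lebesgue_measure R]_p
          [(EFin \o modulus f) \_ (`]0%R, 1%R[ : set R)])%E.

Definition Xspace (R : realType) (p : \bar R) : set (R -> R[i]) :=
  if p == +oo%E then
    [set f : R -> R[i] |
      [/\ periodic f 1,
          continuous (fun t : R => complex.Re (f t)) &
          continuous (fun t : R => complex.Im (f t))]]
  else
    [set f : R -> R[i] |
      [/\ measurable_fun (`]0%R, 1%R[ : set R)
            (fun t : R => complex.Re (f t)),
          measurable_fun (`]0%R, 1%R[ : set R)
            (fun t : R => complex.Im (f t)) &
          (Xnorm p f < +oo)%E]].

Definition linear_span (R : realType) (S : set (R -> R[i])) :
    set (R -> R[i]) :=
  [set h | exists (n : nat) (c : 'I_n -> R[i]) (g : 'I_n -> (R -> R[i])),
     (forall i, S (g i)) /\ h = (fun t => \sum_(i < n) c i * g i t)].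

(* For finite p, Xnorm is only a seminorm on Xspace; density for it is density
   in the quotient by almost everywhere equality. *)
Definition totalX (R : realType) (p : \bar R) (S : set (R -> R[i])) : Prop :=
  S `<=` Xspace p /\
  forall f : R -> R[i], Xspace p f -> forall eps : R, 0 < eps ->
    exists2 h, linear_span S h & (Xnorm p (fun t => f t - h t)%R < eps%:E)%E.

Definition cos_powers (R : realType) (theta : R) (L : set nat) :
    set (R -> R[i]) :=
  [set (fun t : R => (cos (2 * pi * (t - theta)) ^+ l)%:C) | l in L].

Definition Muntz_Szasz (R : realType) (L : set nat) : Prop :=
  [/\ L 0%N,
      \esum_(l in [set l | [/\ L l, ~~ odd l & l != 0%N]])
        ((l%:R : R)^-1)%:E = +oo%E &
      \esum_(l in [set l | L l /\ odd l]) ((l%:R : R)^-1)%:E = +oo%E].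

(* Main.v *)
Require Import Defs.
From mathcomp Require Import all_boot all_order all_algebra.
From mathcomp Require Import all_classical all_reals all_analysis.
From mathcomp Require Import measurable_realfun ring lra.
Import Order.TTheory GRing.Theory Num.Theory.
Import numFieldNormedType.Exports.

(** Every step takes place in the uniform closure of the real linear span of
    the system; a complex function is approximated through its real and
    imaginary parts.

    The first ingredient is the Muntz-Szasz theorem.  For an exponent
    [q > 0] and exponents [l_1, l_2, ...] greater than [q], a device of von
    Golitschek turns an error [P = x^q - (combination of earlier powers)]
    into an error [S] of the same form that also uses [x^l], namely the
    solution of [x S' - l S = (q - l) P] with [S(1) = 0].  At an interior
    extremum of [S] the derivative vanishes, so on [0, 1] one has
    [|S| <= (1 - q / l) sup |P|] ([euler_operator_bound]).  The product of
    these factors tends to 0 as soon as the sum of the [1 / l] diverges.  The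
    even and the odd exponents of a Muntz-Szasz set therefore approximate, by
    parity, all the powers on [-1, 1] ([muntz_szasz]), and after composition
    with a cosine the closure contains all powers of
    [cos (2 pi (t - theta))] for both angles [theta].

    These powers span the same space as the [cos (2 pi k (t - theta))].  As
    [theta1 - theta2] is irrational, [sin (2 pi k (theta1 - theta2))] does not
    vanish for [k > 0], and the two cosines of frequency [k] span every
    translate [cos (2 pi k (t - s))] ([cos_mult_rotate]).  Hence the closure
    contains all powers of [cos (2 pi (t - s))], for every [s]
    ([cos_pow_unif_closure]).

    It remains to see that these are dense.  For continuous [f] with
    [f 0 = f 1] the approximant is a discrete convolution
    [sum_j f(j/N) K_n(t - j/N) / A_n] with [K_n(t) = cos^(2n) (pi t)].  For
    [n < N] the sum [A_n] of the kernels is constant in [t], and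
    differentiating [A_(n+1)] twice gives
    [(2 n + 2) A_(n+1) = (2 n + 1) A_n].  Together with
    [|f t - f s| <= e + C sin^2 (pi (t - s))] ([circle_modulus]) this bounds
    the error by [e + C / (2 n + 2)] ([continuous_unif_closure]).  For
    [p = +oo] this is the conclusion.  For finite [p] an element of [L^p] is
    truncated, approximated in [L^1] by a continuous bounded function and
    multiplied by a cutoff vanishing at both ends of the interval
    ([Lp_dense]). *)

Set Implicit Arguments.
Unset Strict Implicit.
Unset Printing Implicit Defensive.

Local Open Scope classical_set_scope.
Local Open Scope ring_scope.

(** * Linear spans and uniform closures *)

Section LinearSpan.
Variables (K : pzRingType) (V : lmodType K).
Implicit Types (S : set V) (u v : V).

(** Linear combinations are built one term at a time, so that a property stable
    under linear combinations is proved by induction on this predicate; this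
    serves for parity, measurability, periodicity and changes of basis. *)
Inductive lspan S : V -> Prop :=
| lspan0 : lspan S 0
| lspan_cons a u v : S u -> lspan S v -> lspan S (a *: u + v).

Lemma lspanD S u v : lspan S u -> lspan S v -> lspan S (u + v).
Proof.
elim=> [|a x y Sx _ IH] hv; first by rewrite add0r.
by rewrite -addrA; apply: lspan_cons => //; exact: IH.
Qed.

Lemma lspanZ S a u : lspan S u -> lspan S (a *: u).
Proof.
elim=> [|b x y Sx _ IH]; first by rewrite scaler0; exact: lspan0.
by rewrite scalerDr scalerA; apply: lspan_cons.
Qed.

Lemma lspan_in S u : S u -> lspan S u.
Proof.
move=> Su; rewrite -[u]addr0 -[u]scale1r.
by apply: lspan_cons => //; exact: lspan0.
Qed.

Lemma lspan_sum S (I : Type) (r : seq I) (F : I -> V) :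
  (forall i, lspan S (F i)) -> lspan S (\sum_(i <- r) F i).
Proof.
move=> h; elim: r => [|i r IH]; first by rewrite big_nil; exact: lspan0.
by rewrite big_cons; apply: lspanD.
Qed.

Lemma lspan_bind S S' u :
  (forall v, S v -> lspan S' v) -> lspan S u -> lspan S' u.
Proof.
move=> h; elim=> [|a x y Sx _ IH]; first exact: lspan0.
by apply: lspanD => //; apply: lspanZ; exact: h.
Qed.

End LinearSpan.

Section UniformClosure.
Variable (T : Type) (R : realType).
Implicit Types (A : set T) (S : set (T -> R)) (f g : T -> R).

Definition unif_closure A S f := forall e : R, 0 < e ->
  exists2 h, lspan S h & forall x, A x -> `|f x - h x| <= e.

Lemma unif_closure_in A S f : lspan S f -> unif_closure A S f.
Proof.
by move=> Sf e e0; exists f => // x _; rewrite subrr normr0 ltW.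
Qed.

Lemma unif_closure_subset A B S f :
  A `<=` B -> unif_closure B S f -> unif_closure A S f.
Proof. by move=> AB hf e /hf[h Sh fh]; exists h => // x /AB; exact: fh. Qed.

Lemma unif_closureD A S f g : unif_closure A S f -> unif_closure A S g ->
  unif_closure A S (f + g).
Proof.
move=> hf hg e e0; have e20 : 0 < e / 2 by rewrite divr_gt0.
have [f' Sf' ff'] := hf _ e20; have [g' Sg' gg'] := hg _ e20.
exists (f' + g'); first exact: lspanD.
move=> x Ax; have -> : (f + g) x - (f' + g') x = (f x - f' x) + (g x - g' x).
  by rewrite !fctE; ring.
by rewrite (le_trans (ler_normD _ _))// [e]splitr lerD ?ff' ?gg'.
Qed.

Lemma unif_closureZ A S a f : unif_closure A S f -> unif_closure A S (a *: f).
Proof.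
move=> hf e e0; have a0 : 0 < `|a| + 1 by rewrite ltr_wpDl.
have [f' Sf' ff'] := hf (e / (`|a| + 1)) (divr_gt0 e0 a0).
exists (a *: f'); first exact: lspanZ.
move=> x Ax; have -> : (a *: f) x - (a *: f') x = a * (f x - f' x).
  by rewrite !fctE /GRing.scale/=; ring.
rewrite normrM.
have := ff' x Ax; rewrite ler_pdivlMr// => ub; apply: le_trans ub.
by rewrite [leLHS]mulrC mulrDr mulr1 lerDl.
Qed.

(** The uniform closure is idempotent: it suffices to approximate the
    generators, since a linear combination of functions of the closure is again
    in the closure. *)
Lemma unif_closure_trans A S S' f : (forall g, S g -> unif_closure A S' g) ->
  unif_closure A S f -> unif_closure A S' f.
Proof.
move=> h hf e e0; have e20 : 0 < e / 2 by rewrite divr_gt0.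
have [g Sg fg] := hf _ e20.
have clg : unif_closure A S' g.
  elim: Sg {fg} => [|a x y Sx _ IH].
    by apply: unif_closure_in; exact: lspan0.
  by apply: unif_closureD => //; apply: unif_closureZ; exact: h.
have [g' Sg' gg'] := clg _ e20.
exists g' => // x Ax; rewrite -[f x](subrK (g x)) -addrA.
by rewrite (le_trans (ler_normD _ _))// [e]splitr lerD ?fg ?gg'.
Qed.

End UniformClosure.

Lemma unif_closure_comp (T U : Type) (R : realType) (A : set T) (B : set U)
    (phi : U -> T) (S : set (T -> R)) (f : T -> R) :
  (forall u, B u -> A (phi u)) ->
  unif_closure A S f -> unif_closure B [set g \o phi | g in S] (f \o phi).
Proof.
move=> BA hf e e0; have [h Sh fh] := hf _ e0.
exists (h \o phi); last by move=> u /BA; exact: fh.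
elim: Sh {fh} => [|a x y Sx _ IH]; first exact: lspan0.
by apply: (@lspan_cons _ _ _ a (x \o phi) (y \o phi)) => //; exists x.
Qed.

(** * The Golitschek recursion *)

Section Muntz.
Variable R : realType.
Implicit Types (P S : {poly R}) (F : seq nat).

(** A maximum principle for the operator [S -> x S' - l S].  Where [S] attains
    its maximum over [0, 1], either [x = 0], or [x = 1] where [S] vanishes, or
    [S' = 0]; except at 1 this leaves [- l S = c P]. *)
Lemma euler_operator_ub P S (c l M x : R) : 0 < l ->
  (forall y, y \in `[0, 1] -> `|P.[y]| <= M) ->
  'X * S^`() - l *: S = c *: P -> S.[1] = 0 ->
  x \in `[0, 1] -> l * S.[x] <= `|c| * M.
Proof.
move=> l0 PM eqS S1 x01.
have [z z01 zmax] := EVT_max (@ler01 R)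
  (continuous_subspaceT (@continuous_horner R S)).
have cM : 0 <= `|c| * M.
  by rewrite mulr_ge0// (le_trans _ (PM _ x01)).
apply: (@le_trans _ _ (l * S.[z])); first by rewrite ler_pM2l// zmax.
have [z1|zN1] := eqVneq z 1; first by rewrite z1 S1 mulr0.
have zS' : z * S^`().[z] = 0.
  have [->|zN0] := eqVneq z 0; first by rewrite mul0r.
  have zoo : z \in `]0, 1[.
    by move: z01; rewrite !in_itv/= !lt_neqAle eq_sym zN0 zN1.
  suff -> : S^`().[z] = 0 by rewrite mulr0.
  have Sz0 : is_derive z 1 (horner S) 0.
    apply: (derive1_at_max (@ler01 R)) zoo _ => [t _|t t01].
      exact: derivable_horner.
    by apply: zmax; exact: subset_itv_oo_cc.
  by rewrite derivE derive1E; exact: derive_val.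
have := congr1 (horner ^~ z) eqS; rewrite !hornerE zS' sub0r => eqz.
rewrite -[l * _]opprK eqz (le_trans (ler_norm _))// normrN normrM.
by rewrite ler_wpM2l// PM.
Qed.

Lemma euler_operator_bound P S (c l M x : R) : 0 < l ->
  (forall y, y \in `[0, 1] -> `|P.[y]| <= M) ->
  'X * S^`() - l *: S = c *: P -> S.[1] = 0 ->
  x \in `[0, 1] -> `|S.[x]| <= `|c| / l * M.
Proof.
move=> l0 PM eqS S1 x01.
rewrite -mulrA [l^-1 * _]mulrC mulrA ler_pdivlMr// mulrC.
have := @euler_operator_ub P (- S) (- c) l M x l0 PM.
rewrite derivN hornerN S1 oppr0 normrN mulrN scalerN scaleNr -eqS -opprD.
move=> /(_ erefl erefl x01); rewrite hornerN mulrN => lbS.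
have [S0|S0] := ger0P S.[x]; last by rewrite mulrN.
exact: euler_operator_ub eqS S1 x01.
Qed.

Lemma mulX_derivXn n : 'X * ('X^n)^`() = n%:R *: 'X^n :> {poly R}.
Proof.
rewrite derivXn; case: n => [|n]; first by rewrite mulr0n mulr0 scale0r.
by rewrite mulrnAr -exprS scaler_nat.
Qed.

Definition monomials F : set {poly R} := [set 'X^l | l in [set` F]].

(** On monomials the operator acts by [x^m -> (m - l) x^m], and it kills [x^l].
    For [m <> l], [x^m] is thus the image of a multiple of [x^m], and adding a
    multiple of [x^l] makes the preimage vanish at 1. *)
Lemma euler_operator_solve F (q l : nat) P :
  l \notin F -> lspan (monomials F) P ->
  exists S, [/\ lspan (monomials (l :: F)) S, S.[1] = 0 &
    'X * S^`() - l%:R *: S = (q%:R - l%:R) *: P].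
Proof.
move=> lF; elim=> [|a u v [m /= Fm <-] _ [S [FS S1 eqS]]].
  exists 0; rewrite deriv0 horner0 mulr0 !scaler0 subr0.
  by split => //; exact: lspan0.
have ml : m%:R - l%:R != 0 :> R.
  by rewrite subr_eq0 eqr_nat; apply: contraNneq lF => <-.
pose b : R := (q%:R - l%:R) * a / (m%:R - l%:R).
exists (b *: ('X^m - 'X^l) + S); split.
- apply: lspanD; last first.
    by apply: lspan_bind FS => _ [n nF <-]; apply: lspan_in; exists n.
  apply/lspanZ/lspanD.
    by apply: lspan_in; exists m => //=; rewrite inE Fm orbT.
  rewrite -scaleN1r; apply/lspanZ/lspan_in; exists l => //=.
  by rewrite inE eqxx.
- by rewrite !hornerE S1 !expr1n subrr mulr0 addr0.
- rewrite derivD derivZ derivB mulrDr -scalerAr mulrBr !mulX_derivXn.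
  rewrite [l%:R *: (_ + _)]scalerDr opprD addrACA eqS [RHS]scalerDr.
  congr (_ + _).
  rewrite [l%:R *: (b *: _)]scalerA [l%:R * b]mulrC -[(b * _) *: _]scalerA.
  rewrite -scalerBr [l%:R *: (_ - _)]scalerBr opprB addrA addrNK -scalerBl.
  by rewrite !scalerA /b mulfVK.
Qed.

(** With [F = l :: F'] and [P] approximating [x^q] by means of [F'], the next
    error [x^q - (x^l + S)] solves the equation of the maximum principle with
    right-hand side [(q - l) (x^q - P)], because [x^q - x^l] is mapped to
    [(q - l) x^q].  The bound is multiplied by [(l - q) / l = 1 - q / l]. *)
Lemma golitschek_approximation F (q : nat) : uniq F -> all (ltn q) F ->
  exists2 P, lspan (monomials F) P & forall x : R, x \in `[0, 1] ->
    `|x ^+ q - P.[x]| <= \prod_(l <- F) (1 - q%:R / l%:R).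
Proof.
elim: F => [|l F IH] /=.
  move=> _ _; exists 0; first exact: lspan0.
  move=> x /[!in_itv]/= /andP[x0 x1].
  by rewrite horner0 subr0 big_nil ger0_norm ?exprn_ge0// exprn_ile1.
move=> /andP[lF uF] /andP[ql qF]; have [P FP Pq] := IH uF qF.
have [S [FS S1 eqS]] := euler_operator_solve q lF FP.
have l0 : 0 < l%:R :> R by rewrite ltr0n (leq_trans _ ql).
exists ('X^l + S).
  rewrite -['X^l]scale1r; apply: lspan_cons => //.
  by exists l => //=; rewrite inE eqxx.
move=> x x01; rewrite big_cons.
set M := \prod_(i <- F) _ in Pq *.
have -> : 1 - q%:R / l%:R = `|q%:R - l%:R| / l%:R :> R.
  rewrite ler0_norm ?subr_le0 ?ler_nat 1?ltnW// opprB mulrBl divff//.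
  exact: lt0r_neq0.
have -> : x ^+ q - ('X^l + S).[x] = ('X^q - ('X^l + S)).[x] by rewrite !hornerE.
apply: (euler_operator_bound l0 (P := 'X^q - P)) => //.
- by move=> y /Pq; rewrite !hornerE.
- rewrite derivB derivD mulrBr mulrDr !mulX_derivXn scalerBr scalerDr.
  rewrite scalerBr -eqS scalerBl !opprD !addrA; ring.
- by rewrite !hornerE !expr1n S1 addr0 subrr.
Qed.
End Muntz.

(** * The Muntz-Szasz theorem on the symmetric interval *)

Section MuntzDense.
Variable R : realType.
Implicit Types (A : set nat) (F : seq nat).

(** Follows by induction from [(1 - a) (1 + a + s) <= 1 + s]; this form of the
    usual estimate by [exp (- q sum 1 / l)] avoids exponentials. *)
Lemma prod_onesub_le F (q : R) : 0 <= q -> (forall l, l \in F -> q < l%:R) ->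
  0 <= \prod_(l <- F) (1 - q / l%:R) <= (1 + q * \sum_(l <- F) l%:R^-1)^-1.
Proof.
move=> q0; elim: F => [|l F IH] qF.
  by rewrite !big_nil mulr0 addr0 invr1 ler01 lexx.
have /andP[P0 PF] : 0 <= \prod_(l <- F) (1 - q / l%:R) <=
    (1 + q * \sum_(l <- F) l%:R^-1)^-1.
  by apply: IH => m mF; apply: qF; rewrite inE mF orbT.
have ql := qF l (mem_head _ _).
have l0 : 0 < l%:R :> R := le_lt_trans q0 ql.
rewrite !big_cons mulrDr.
set s := q * \sum_(i <- F) _ in PF *.
have s0 : 0 <= s by rewrite mulr_ge0// sumr_ge0.
have a0 : 0 <= q / l%:R by rewrite divr_ge0// ltW.
have a1 : q / l%:R < 1 by rewrite ltr_pdivrMr// mul1r.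
set a := q / l%:R in a0 a1 *.
rewrite mulr_ge0 ?subr_ge0 ?(ltW a1)//=.
apply: le_trans (ler_wpM2l _ PF) _; first by rewrite subr_ge0 ltW.
rewrite ler_pdivrMr ?ltr_wpDr// mulrC ler_pdivlMr; last first.
  by rewrite ltr_wpDr ?addr_ge0.
nra.
Qed.

(** Discarding the exponents [l <= q] costs at most [q + 1] in the sum. *)
Lemma esum_inv_tail A (q : nat) (B : R) :
  \esum_(l in A) (l%:R^-1 : R)%:E = +oo%E ->
  exists F, [/\ uniq F, all (ltn q) F, [set` F] `<=` A &
    B < \sum_(l <- F) l%:R^-1].
Proof.
move=> Aoo.
have : ((B + q.+1%:R)%:E < \esum_(l in A) (l%:R^-1 : R)%:E)%E by rewrite Aoo ltry.
move=> /ereal_sup_gt[_ [X [finX XA] <-]].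
have [r Xr] := (finite_seqP X).1 finX; pose s := undup r.
have {Xr}Xs : X = [set` s].
  by rewrite Xr; apply/seteqP; split => l /=; rewrite mem_undup.
have us : uniq s := undup_uniq r.
rewrite Xs -fsbig_seq// sumEFin lte_fin => ltB.
exists [seq l <- s | (q < l)%N]; split.
- by rewrite filter_uniq.
- exact: filter_all.
- move=> l /=; rewrite mem_filter => /andP[_].
  by move=> ls; apply: XA; rewrite Xs.
rewrite -(ltrD2r q.+1%:R) (lt_le_trans ltB)//.
rewrite (bigID (fun l => (q < l)%N))/= big_filter lerD2l.
rewrite -big_filter.
apply: (@le_trans _ _ (\sum_(l <- [seq l <- s | ~~ (q < l)%N]) 1)).
  (* the inverse of 0 is 0, so that the exponent 0 does not contribute *)
  apply: ler_sum => l _; case: l => [|l]; first by rewrite invr0.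
  by rewrite invf_le1 ?ler1n.
rewrite big_const_seq count_predT iter_addr_0 ler_nat -[leqRHS](size_iota 0).
apply: uniq_leq_size; first by rewrite filter_uniq.
by move=> l; rewrite mem_filter -leqNgt mem_iota add0n ltnS => /andP[].
Qed.

Definition powers A : set (R -> R) := [set (fun x => x ^+ l) | l in A].

Lemma muntz_szasz01 A (q : nat) : (0 < q)%N ->
  \esum_(l in A) (l%:R^-1 : R)%:E = +oo%E ->
  unif_closure `[0, 1] (powers A) (fun x => x ^+ q).
Proof.
move=> q0 Aoo e e0.
have [F [uF qF FA ltF]] := esum_inv_tail q (e^-1 / q%:R) Aoo.
have [P FP Pq] := golitschek_approximation R uF qF.
exists (horner P).
  elim: FP {Pq} => [|a u v [l Fl <-] _ IH].
    by rewrite horner0_ext; exact: lspan0.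
  rewrite (_ : horner _ = a *: (fun x => x ^+ l) + horner v).
    by apply: lspan_cons => //; exists l => //; exact: FA.
  by apply/funext => x; rewrite !hornerE.
move=> x x01; apply: le_trans (Pq _ x01) _.
have q0R : 0 < q%:R :> R by rewrite ltr0n.
have /andP[_ le2] := @prod_onesub_le F q%:R (ltW q0R)
  (fun l lF => etrans (ltr_nat _ _ _) (allP qF l lF)).
apply: le_trans le2 _; move: ltF; rewrite ltr_pdivrMr// mulrC => ltF.
have ei : 0 < e^-1 by rewrite invr_gt0.
rewrite -[leRHS]invrK lef_pV2 ?posrE//; lra.
Qed.

(** The approximants of [x^q] on [0, 1] by exponents of the same parity as [q]
    have the parity of [x^q], hence also approximate it on [-1, 0]. *)
Lemma muntz_szasz A (q : nat) : Muntz_Szasz R A ->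
  unif_closure `[-1, 1] (powers A) (fun x => x ^+ q).
Proof.
move=> [A0 Aeven Aodd].
have [->|q0] := posnP q.
  by apply/unif_closure_in/lspan_in; exists 0%N.
suff parity B : B `<=` A -> (forall l, B l -> odd l = odd q) ->
    \esum_(l in B) (l%:R^-1 : R)%:E = +oo%E ->
    unif_closure `[-1, 1] (powers A) (fun x => x ^+ q).
  have [oq|eq] := boolP (odd q).
    by apply: parity Aodd => l []// _ ->.
  by apply: parity Aeven => l []// _ /negbTE -> _; rewrite (negbTE eq).
move=> BA Bq Boo e e0.
have [h Bh hq] := muntz_szasz01 q0 Boo e0.
exists h.
  apply: lspan_bind Bh => _ [l Bl <-].
  by apply/lspan_in; exists l => //; exact: BA.
have hN x : h (- x) = (-1) ^+ q * h x.
  elim: Bh {hq} => [|a u v [l Bl <-] _ IH]; first by rewrite /= mulr0.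
  rewrite !fctE IH (exprNn x) -[(-1) ^+ l]signr_odd Bq// signr_odd.
  by rewrite /GRing.scale/=; ring.
move=> x; rewrite /= in_itv/= => /andP[x1 x2].
have [x0|x0] := leP 0 x; first by apply: hq; rewrite /= in_itv/= x0.
have Nx01 : 0 <= - x <= 1 by apply/andP; split; lra.
have := hq (- x); rewrite /= in_itv/= Nx01 => /(_ isT).
by rewrite hN (exprNn x) -mulrBr normrM normrX normrN1 expr1n mul1r.
Qed.
End MuntzDense.

(** * Cosines of multiple angles and powers of cosines *)

Section Cosines.
Variable R : realType.
Implicit Types (s t x theta : R) (k n : nat).

Definition cos_pow s n : R -> R := fun t => cos (2 * pi * (t - s)) ^+ n.

Definition cos_mult s k : R -> R := fun t => cos (k%:R * (2 * pi * (t - s))).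

(** The zeros of the sine are the multiples of [pi]: reduce [x >= 0] to
    [0 <= y < pi] by subtracting multiples of [pi]. *)
Lemma sin_eq0_rational x : sin x = 0 -> rational (x / pi).
Proof.
have ppi : 0 < pi :> R := @pi_gt0 R.
wlog x0 : x / 0 <= x => [th|sx0].
  have [x0|x0 sx0] := leP 0 x; first exact: th.
  have /rationalP[a [b eb]] : rational (- x / pi).
    by apply: th; [rewrite oppr_ge0 ltW|rewrite sinN sx0 oppr0].
  apply/rationalP; exists (- a), b.
  by rewrite -[LHS]opprK -mulNr eb rmorphN mulNr.
have /truncn_itv/andP[lo hi] : 0 <= x / pi by rewrite divr_ge0// ltW.
set m := Num.truncn _ in lo hi *.
pose y := x - pi *+ m.
have y0 : 0 <= y by rewrite subr_ge0 -mulr_natl -ler_pdivlMr.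
have ypi : y < pi.
  by rewrite ltrBlDr -mulrS -mulr_natl -ltr_pdivrMr.
have sy0 : sin y = 0.
  have := alternatingn (@sinDpi R) m y; rewrite subrK sx0 => /esym/eqP.
  by rewrite mulf_eq0 signr_eq0 => /eqP.
have /eqP : y = 0.
  apply/eqP; rewrite eq_le y0 andbT leNgt; apply/negP => ygt0.
  by have := @sin_gt0_pi R y; rewrite sy0 ltxx ygt0 ypi => /(_ isT).
rewrite subr_eq0 => /eqP ->; apply/rationalP; exists m, 1%N.
by rewrite -[pi *+ m]mulr_natl mulfK ?gt_eqF// divr1.
Qed.

Lemma cos_mulcos_mult s k t : cos (2 * pi * (t - s)) * cos_mult s k.+1 t =
  2^-1 * cos_mult s k.+2 t + 2^-1 * cos_mult s k t.
Proof.
rewrite /cos_mult; set x := 2 * pi * (t - s).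
have -> : k.+2%:R * x = k.+1%:R * x + x by rewrite -natr1; ring.
have -> : k%:R * x = k.+1%:R * x - x by rewrite -[k.+1%:R]natr1; ring.
by rewrite cosD cosB; field.
Qed.

(** The recursion of the Chebyshev polynomials,
    [cos ((k + 2) x) = 2 cos x cos ((k + 1) x) - cos (k x)]. *)
Lemma cos_mult_span s k : lspan [set cos_pow s n | n in setT] (cos_mult s k).
Proof.
have mulcos f : lspan [set cos_pow s n | n in setT] f ->
    lspan [set cos_pow s n | n in setT]
      (fun t => cos (2 * pi * (t - s)) * f t).
  elim=> [|a _ v [n _ <-] _ IH].
    rewrite (_ : (fun t => _) = 0); first exact: lspan0.
    by apply/funext => t; rewrite mulr0.
  rewrite (_ : (fun t => _) =
      a *: cos_pow s n.+1 + (fun t => cos (2 * pi * (t - s)) * v t)).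
    by apply: lspan_cons => //; exists n.+1.
  by apply/funext => t; rewrite !fctE /GRing.scale/= /cos_pow exprS; ring.
suff [] : lspan [set cos_pow s n | n in setT] (cos_mult s k) /\
  lspan [set cos_pow s n | n in setT] (cos_mult s k.+1) by [].
elim: k => [|k [IH0 IH1]].
  split; apply: lspan_in; [exists 0%N|exists 1%N] => //; apply/funext => t.
    by rewrite /cos_pow /cos_mult mul0r cos0.
  by rewrite /cos_pow /cos_mult mul1r expr1.
split => //.
rewrite (_ : cos_mult s k.+2 =
    2 *: (fun t => cos (2 * pi * (t - s)) * cos_mult s k.+1 t) - cos_mult s k);
    last first.
  by apply/funext => t; rewrite !fctE /GRing.scale/= cos_mulcos_mult; field.
rewrite -[- cos_mult s k]scaleN1r; apply: lspanD; apply: lspanZ => //.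
exact: mulcos.
Qed.

(** The frequencies occurring in [cos^n] are at most [n]; the discrete sums of
    kernels below rely on this bound. *)
Lemma cos_pow_span s n :
  lspan [set cos_mult s k | k in `I_n.+1] (cos_pow s n).
Proof.
elim: n => [|n IH].
  apply: lspan_in; exists 0%N => //; apply/funext => t.
  by rewrite /cos_pow /cos_mult mul0r cos0.
rewrite (_ : cos_pow s n.+1 =
    (fun t => cos (2 * pi * (t - s)) * cos_pow s n t)); last first.
  by apply/funext => t; rewrite /cos_pow exprS.
elim: IH => [|a _ v [k kn <-] _ {}IH].
  rewrite (_ : (fun t => _) = 0); first exact: lspan0.
  by apply/funext => t; rewrite mulr0.
rewrite (_ : (fun t => _) =
    a *: (fun t => cos (2 * pi * (t - s)) * cos_mult s k t) +
    (fun t => cos (2 * pi * (t - s)) * v t)); last first.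
  by apply/funext => t; rewrite !fctE /GRing.scale/=; ring.
apply: lspanD => //; apply: lspanZ.
case: k kn => [|k] kn.
  apply: lspan_in; exists 1%N => //; apply/funext => t.
  by rewrite /cos_mult mul0r cos0 mulr1 mul1r.
rewrite (_ : (fun t => _) = 2^-1 *: cos_mult s k.+2 + 2^-1 *: cos_mult s k).
  apply: lspanD; apply/lspanZ/lspan_in; [exists k.+2|exists k] => //=.
  by rewrite (leq_trans _ (leqW kn)).
by apply/funext => t; rewrite cos_mulcos_mult.
Qed.

(** The only use of irrationality: with [D = 2 pi k (theta1 - theta2)] and
    [sin D <> 0], the addition formula for [cos (y + D)] expresses [sin y] by
    [cos y] and [cos (y + D)], hence also [cos (y + d)] for every [d]. *)
Lemma cos_mult_rotate theta1 theta2 s k : irrational (theta1 - theta2) ->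
  lspan [set cos_mult theta1 k; cos_mult theta2 k] (cos_mult s k).
Proof.
move=> irr; have [->|k0] := eqVneq k 0%N.
  by apply: lspan_in; left; apply/funext => t; rewrite /cos_mult !mul0r.
pose D : R := k%:R * (2 * pi * (theta1 - theta2)).
pose d : R := k%:R * (2 * pi * (theta1 - s)).
have kR0 : k%:R != 0 :> R by rewrite pnatr_eq0.
have pi0 : pi != 0 :> R by rewrite gt_eqF// pi_gt0.
have sD0 : sin D != 0.
  apply/eqP => /sin_eq0_rational/rationalP[a [b eab]]; apply: irr.
  apply/rationalP; exists a, (b * (k * 2))%N.
  have -> : theta1 - theta2 = D / pi / (k * 2)%:R.
      rewrite /D natrM; move: pi0; move: (pi : R) => P P0.
    by field; rewrite kR0 P0.
  by rewrite eab [(b * _)%:R]natrM invfM mulrA.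
rewrite (_ : cos_mult s k = (cos d - cos D * sin d / sin D) *: cos_mult theta1 k
   + (sin d / sin D) *: cos_mult theta2 k).
  by apply: lspanD; apply/lspanZ/lspan_in; [left|right].
apply/funext => t; rewrite !fctE /GRing.scale/= /cos_mult.
have -> : k%:R * (2 * pi * (t - s)) = k%:R * (2 * pi * (t - theta1)) + d.
  by rewrite /d; ring.
have -> : k%:R * (2 * pi * (t - theta2)) = k%:R * (2 * pi * (t - theta1)) + D.
  by rewrite /D; ring.
by rewrite !cosD; field.
Qed.

(** Composition with [t -> cos (2 pi (t - theta))] carries the Muntz-Szasz
    theorem to the circle; from powers one passes to multiple angles, rotates
    these, and returns to powers. *)
Lemma cos_pow_unif_closure theta1 theta2 (L L' : set nat) s n :
  irrational (theta1 - theta2) -> Muntz_Szasz R L -> Muntz_Szasz R L' ->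
  unif_closure setT
    ([set cos_pow theta1 l | l in L] `|` [set cos_pow theta2 l | l in L'])
    (cos_pow s n).
Proof.
move=> irr hL hL'; set S := (X in unif_closure _ X _).
have powS theta (M : set nat) : Muntz_Szasz R M ->
    [set cos_pow theta l | l in M] `<=` S ->
    forall m, unif_closure setT S (cos_pow theta m).
  move=> hM MS m.
  have cosI t : setT t -> `[(-1 : R), 1]%classic (cos (2 * pi * (t - theta))).
    by move=> _; rewrite /= in_itv/= cos_geN1 cos_le1.
  have := unif_closure_comp cosI (muntz_szasz m hM).
  apply: unif_closure_trans => _ [_ [l Ml <-] <-].
  by apply/unif_closure_in/lspan_in/MS; exists l.
have multS theta (M : set nat) : Muntz_Szasz R M ->
    [set cos_pow theta l | l in M] `<=` S ->
    forall k, unif_closure setT S (cos_mult theta k).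
  move=> hM MS k.
  apply: unif_closure_trans (unif_closure_in _ (cos_mult_span theta k)).
  by move=> _ [m _ <-]; exact: powS hM MS m.
have := unif_closure_in setT (cos_pow_span s n).
apply: unif_closure_trans => _ [k _ <-].
have := unif_closure_in setT (cos_mult_rotate s k irr).
apply: unif_closure_trans => _ [->|->].
  by apply: multS hL _ k => g; left.
by apply: multS hL' _ k => g; right.
Qed.

End Cosines.

(** * Discrete sums of a trigonometric kernel *)

Section DiscreteKernel.
Variable R : realType.
Implicit Types (s t x : R) (k m n N : nat) (f : R -> R).

(** [N] times the average of [f] over the translates by the [N]-th parts of the
    period 1; it plays the role of the integral over a period. *)
Definition node_sum N f t : R := \sum_(j < N) f (t - j%:R / N%:R).

(** As [cos^2 (pi t) = (1 + cos (2 pi t)) / 2], this is a nonnegative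
    trigonometric polynomial of degree [n] and period 1, with its maximum at
    the integers. *)
Definition kernel n : R -> R := fun t => cos (pi * t) ^+ n.*2.

Lemma cos_sin_diff x h : sin h != 0 ->
  cos x = (2 * sin h)^-1 * (sin (x + h) - sin (x - h)).
Proof. by move=> sh; rewrite sinD sinB; field. Qed.

(** The sum telescopes after multiplication by [2 sin h], for [h = pi k / N];
    [sin h] is nonzero since [0 < k < N], and the two end terms agree by
    periodicity. *)
Lemma node_sum_cos_mult N k t :
  (0 < k < N)%N -> node_sum N (cos_mult 0 k) t = 0.
Proof.
move=> /andP[k0 kN].
have N0 : N%:R != 0 :> R by rewrite pnatr_eq0 -lt0n (ltn_trans k0).
have k0R : 0 < k%:R :> R by rewrite ltr0n.
have N0R : 0 < N%:R :> R by rewrite ltr0n (ltn_trans k0).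
have p0 : 0 < pi :> R := @pi_gt0 R.
pose h : R := pi * k%:R / N%:R.
have sh : sin h != 0.
  rewrite gt_eqF// sin_gt0_pi// /h -mulrA mulr_gt0 ?divr_gt0//=.
  by rewrite gtr_pMr// ltr_pdivrMr// mul1r ltr_nat.
pose x := k%:R * (2 * pi * t).
pose g j := sin (x + h - h *+ 2 *+ j).
have step j : cos_mult 0 k (t - j%:R / N%:R) = (2 * sin h)^-1 * (g j - g j.+1).
  have -> : cos_mult 0 k (t - j%:R / N%:R) = cos (x - h *+ 2 *+ j).
    rewrite /cos_mult /x /h -mulr_natr -[_ *+ 2]mulr_natr; congr cos.
    by move: (pi : R) => P; field.
  rewrite [LHS](cos_sin_diff _ sh) /g; congr (_ * (sin _ - sin _)).
    by rewrite addrAC.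
  rewrite [h *+ 2 *+ j.+1]mulrSr opprD addrA [_ + h - _]addrAC mulr2n opprD.
  by rewrite addrA addrK.
rewrite /node_sum; under eq_bigr do rewrite step.
rewrite -big_distrr/= -(big_mkord predT (fun j => g j - g j.+1)).
under eq_bigr do rewrite -opprB.
have hN : h *+ 2 *+ N = pi *+ 2 *+ k.
  by rewrite /h -[_ *+ N]mulr_natr mulrnAl divfK// mulr_natr mulrnAC.
have gN : g N = g 0%N.
  rewrite /g hN mulr0n subr0 -[in RHS](subrK (pi *+ 2 *+ k) (x + h)).
  by rewrite (periodicn (@sinD2pi R)).
by rewrite sumrN telescope_sumr// gN subrr oppr0 mulr0.
Qed.

Lemma node_sum_lspan N n f t : (n < N)%N ->
  lspan [set cos_mult 0 k | k in `I_n.+1] f -> node_sum N f t = node_sum N f 0.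
Proof.
move=> nN; elim=> [|a _ v [k /= kn <-] _ IH]; first by [].
have lin y : node_sum N (a *: cos_mult 0 k + v) y =
    a * node_sum N (cos_mult 0 k) y + node_sum N v y.
  by rewrite /node_sum big_distrr -big_split.
rewrite !lin IH; congr (_ * _ + _).
case: k {lin} kn => [|k] kn.
  by apply: eq_bigr => j _; rewrite /cos_mult !mul0r.
by rewrite !node_sum_cos_mult// (leq_trans kn nN).
Qed.

Lemma kernel_cos_pow n s :
  lspan [set cos_pow s m | m in `I_n.+1] (fun t => kernel n (t - s)).
Proof.
rewrite (_ : (fun t => _) =
    2^-1 ^+ n *: \sum_(i < n.+1) 'C(n, i)%:R *: cos_pow s i).
  apply/lspanZ/lspan_sum => i; apply/lspanZ/lspan_in; exists (i : nat) => //=.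
apply/funext => t; rewrite /kernel -mul2n exprM.
have -> : cos (pi * (t - s)) ^+ 2 = 2^-1 * (1 + cos (2 * pi * (t - s))).
  have -> : 2 * pi * (t - s) = (pi * (t - s)) *+ 2 by rewrite mulr2n; ring.
  by rewrite cos_mulr2n -mulr_natr; field.
rewrite exprMn exprDn !fctE /GRing.scale/= fct_sumE; congr (_ * _).
by apply: eq_bigr => i _; rewrite expr1n mul1r -mulr_natl.
Qed.

Lemma node_sum_kernel N n t : (n < N)%N ->
  node_sum N (kernel n) t = node_sum N (kernel n) 0.
Proof.
move=> nN; apply: (node_sum_lspan _ nN); have := kernel_cos_pow n 0.
rewrite (_ : (fun t => _) = kernel n); last by apply/funext => z; rewrite subr0.
apply: lspan_bind => _ [m /= mn <-].
apply: lspan_bind (cos_pow_span 0 m) => _ [k /= km <-].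
by apply: lspan_in; exists k => //=; exact: leq_trans km mn.
Qed.

(** Node sums commute with differentiation. *)
Lemma node_sum_derive N f f' c t : (forall x, is_derive x 1 f (f' x)) ->
  (forall x, node_sum N f x = c) -> node_sum N f' t = 0.
Proof.
move=> ff' fc.
have d : is_derive t (1 : R) (\sum_(j < N) (fun x => f (x - j%:R / N%:R)))
    (\sum_(j < N) f' (t - j%:R / N%:R)).
  apply: is_derive_sum => j.
  have := @is_derive1_comp _ f (shift (- (j%:R / N%:R))) t _ 1 (ff' _)
    (is_derive_shift _ _ _).
  by rewrite mulr1.
have e : \sum_(j < N) (fun x => f (x - j%:R / N%:R)) = cst c.
  by apply/funext => x; rewrite fct_sumE; exact: fc.
rewrite e in d.
by have := @derive_val _ _ _ _ _ _ _ d; rewrite derive_cst => /esym.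
Qed.

Lemma is_derive_sin_pi x :
  is_derive x 1 (fun y : R => sin (pi * y)) (pi * cos (pi * x)).
Proof.
have dpi : is_derive x 1 (fun y : R => pi * y) pi.
  have := is_deriveZ pi (is_derive_id x (1 : R)).
  by rewrite /GRing.scale/= mulr1.
by rewrite mulrC; exact: (@is_derive1_comp _ (@sin R) (fun y => pi * y)).
Qed.

Lemma is_derive_cos_pi_exp m x : is_derive x 1 (fun y : R => cos (pi * y) ^+ m)
  (- (m%:R * pi * (cos (pi * x) ^+ m.-1 * sin (pi * x)))).
Proof.
have dpi : is_derive x 1 (fun y : R => pi * y) pi.
  have := is_deriveZ pi (is_derive_id x (1 : R)).
  by rewrite /GRing.scale/= mulr1.
have dcos : is_derive x 1 (fun y : R => cos (pi * y)) (- sin (pi * x) * pi).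
  exact: (@is_derive1_comp _ (@cos R) (fun y => pi * y)).
have := is_deriveX m dcos.
rewrite (_ : (fun y : R => cos (pi * y)) ^+ m =
    (fun y => cos (pi * y) ^+ m)); last first.
  by rewrite exprfctE.
by move/is_derive_eq; apply; rewrite /GRing.scale/=; ring.
Qed.

(** The node sum of [K_(n+1)] is constant, so that of its second derivative
    vanishes; with [m = 2 n + 2], the latter is
    [pi^2 (m (m - 1) cos^(m-2) - m^2 cos^m) (pi t)]. *)
Lemma node_sum_kernelS N n t : (n.+1 < N)%N ->
  n.+1.*2%:R * node_sum N (kernel n.+1) t = n.*2.+1%:R * node_sum N (kernel n) t.
Proof.
move=> nN; have p0 : pi != 0 :> R by rewrite gt_eqF// pi_gt0.
pose f' y : R := - (n.+1.*2%:R * pi * (cos (pi * y) ^+ n.*2.+1 * sin (pi * y))).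
have d1 y : node_sum N f' y = 0.
  apply: node_sum_derive (is_derive_cos_pi_exp n.+1.*2) _ => x.
  exact: node_sum_kernel.
pose f'' y : R := - (n.+1.*2%:R * pi) * pi *
  (n.+1.*2%:R * kernel n.+1 y - n.*2.+1%:R * kernel n y).
have df' (y : R) : is_derive y (1 : R) f' (f'' y).
  have := is_deriveZ (- (n.+1.*2%:R * pi))
    (is_deriveM (is_derive_cos_pi_exp n.*2.+1 y) (is_derive_sin_pi y)).
  rewrite (_ : _ \*: _ = f'); last by apply/funext => z; exact: mulNr.
  move/is_derive_eq; apply; rewrite /f'' /kernel doubleS /GRing.scale/=.
  rewrite 2!exprS.
  have := sin2cos2 (pi * y); rewrite expr2.
  set s := sin _; set c := cos _ => ss.
  rewrite exprS; move: (c ^+ n.*2) (pi : R) => C P.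
  by rewrite -[n.*2.+2%:R]natr1 -natr1; ring: ss.
have := node_sum_derive t df' d1.
rewrite /f'' /node_sum -big_distrr/= sumrB -!big_distrr/= => /eqP.
rewrite mulf_eq0 mulf_eq0 oppr_eq0 mulf_eq0 (negbTE p0) !orbF pnatr_eq0/=.
by rewrite subr_eq0 => /eqP.
Qed.
End DiscreteKernel.

(** * Density of trigonometric polynomials *)

Section TrigonometricApproximation.
Variable R : realType.
Implicit Types (f : R -> R).

(** On the unit interval [sin (pi (t - s))] vanishes only for [s = t] and for
    the pair of end points, which represent the same point of the circle. *)
Lemma eq_of_sin_pi_eq0 f (s t : R) : s \in `[0, 1] -> t \in `[0, 1] ->
  sin (pi * (t - s)) = 0 -> f 0 = f 1 -> f t = f s.
Proof.
move=> + + + f01; wlog lest : s t / s <= t => [th s01 t01 st0|].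
  have [st|/ltW ts] := leP s t; first exact: th.
  by apply/esym/th => //; rewrite -opprB mulrN sinN st0 oppr0.
rewrite !in_itv/= => /andP[s0 s1] /andP[t0 t1] st0.
have [->//|nst] := eqVneq s t.
have lst : s < t by rewrite lt_neqAle nst.
have [st1|] := ltP (t - s) 1.
  have ppi := @pi_gt0 R.
  have : 0 < sin (pi * (t - s)).
    by rewrite sin_gt0_pi// mulr_gt0 ?subr_gt0//= gtr_pMr.
  by rewrite st0 ltxx.
move=> h; have -> : t = 1 by lra.
by have -> : s = 0 by lra.
Qed.

(** By compactness of the square.  For fixed [(s, t)], either
    [|f t - f s| < e], or the sine is nonzero and a large [C] gives the strict
    inequality; it persists in a neighbourhood and for all larger [C].  This
    replaces a modulus of continuity on the circle and needs no case
    distinction near the end points. *)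
Lemma circle_modulus f (e : R) : continuous f -> f 0 = f 1 -> 0 < e ->
  exists2 C : R, 0 <= C & forall s t, s \in `[0, 1] -> t \in `[0, 1] ->
    `|f t - f s| <= e + C * sin (pi * (t - s)) ^+ 2.
Proof.
move=> cf f01 e0.
pose phi (n : nat) (z : R * R) :=
  e + n%:R * sin (pi * (z.2 - z.1)) ^+ 2 - `|f z.2 - f z.1|.
pose K : set (R * R) := `[0, 1] `*` `[0, 1].
have cK : compact K by apply: compact_setX; exact: segment_compact.
have phi_le m n z : (m <= n)%N -> phi m z <= phi n z.
  by move=> mn; rewrite lerD2r lerD2l ler_wpM2r ?sqr_ge0// ler_nat.
have cphi n : continuous (phi n).
  move=> z; apply: cvgB.
    apply: cvgD; first exact: cvg_cst.
    apply: cvgMl_tmp; rewrite expr2; under eq_fun do rewrite expr2.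
    have cs : (fun z : R * R => sin (pi * (z.2 - z.1))) @ z -->
        sin (pi * (z.2 - z.1)).
      apply: continuous_comp; last exact: continuous_sin.
      by apply: cvgMl_tmp; apply: cvgB; [exact: cvg_snd|exact: cvg_fst].
    exact: cvgM.
  apply: cvg_norm; apply: cvgB.
    by apply: continuous_comp; [exact: cvg_snd|exact: cf].
  by apply: continuous_comp; [exact: cvg_fst|exact: cf].
have phi_pos z : K z -> exists n, 0 < phi n z.
  case: z => s t [/= s01 t01].
  have [fst|fst] := ltP `|f t - f s| e.
    by exists 0%N; rewrite /phi/= mul0r addr0 subr_gt0.
  have sn0 : sin (pi * (t - s)) ^+ 2 > 0.
    rewrite exprn_even_gt0//=; apply/negP => /eqP s0.
    by move: fst; rewrite (eq_of_sin_pi_eq0 s01 t01 s0 f01) subrr normr0 leNgt e0.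
  exists (Num.truncn (`|f t - f s| / sin (pi * (t - s)) ^+ 2)).+1.
  rewrite /phi/= subr_gt0 ltr_wpDl// ?ltW//.
  by rewrite -ltr_pdivrMr// truncnS_gt.
have := (compact_near_coveringP K).1 cK nat \oo (fun n z => 0 < phi n z) _ _.
move=> [|n _ Kn].
  move=> z Kz; have [n0 n0z] := phi_pos z Kz.
  have : \forall z' \near z, 0 < phi n0 z'.
    exact: cvgr_gt (cphi n0 z) _ n0z.
  move=> h; near=> z' n => /=.
  apply: (lt_le_trans _ (phi_le n0 n z' _)); first by near: z'; exact: h.
  by near: n; exact: nbhs_infty_ge.
exists n%:R => // s t s01 t01.
have := Kn n (leqnn n) (s, t) (conj s01 t01).
by rewrite /phi/= subr_gt0 => /ltW.
Unshelve. all: by end_near.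
Qed.

(** Since [kernel n.+1 = kernel n * (1 - sin^2)], the weighted sum of the terms
    [C sin^2 (pi (t - j/N))] is [C (A_n - A_(n+1)) / A_n = C / (2 n + 2)]. *)
Lemma continuous_unif_closure f : continuous f -> f 0 = f 1 ->
  unif_closure `[0, 1] [set cos_pow sn.1 sn.2 | sn in [set: R * nat]] f.
Proof.
move=> cf f01 e e0; have e20 : 0 < e / 2 by rewrite divr_gt0.
have [C C0 fC] := circle_modulus cf f01 e20.
(* N exceeds n + 1, so that the node sums of kernels n and n + 1 are constant *)
pose n := (Num.truncn (C / e)).+1.
pose N := n.+2.
pose a : R := node_sum N (kernel n) 0.
have kernel_ge0 m x : 0 <= kernel m x :> R.
  by rewrite /kernel -mul2n exprM exprn_ge0// sqr_ge0.
have aE t : node_sum N (kernel n) t = a by exact: node_sum_kernel.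
have a0 : 0 < a.
  rewrite /a /node_sum big_ord_recl ltr_pwDl ?sumr_ge0// mul0r subrr.
  by rewrite /kernel mulr0 cos0 expr1n.
have NR0 : 0 < N%:R :> R by rewrite ltr0n.
exists (\sum_(j < N) (f (j%:R / N%:R) / a) *:
    (fun t => kernel n (t - j%:R / N%:R))).
  apply: lspan_sum => j; apply: lspanZ.
  apply: lspan_bind (kernel_cos_pow n (j%:R / N%:R)) => _ [m _ <-].
  by apply: lspan_in; exists (j%:R / N%:R, m).
move=> t t01; rewrite fct_sumE.
have -> : f t = \sum_(j < N) f t / a * kernel n (t - j%:R / N%:R).
  rewrite -big_distrr/= -[\sum_(_ < _) _]/(node_sum N (kernel n) t) aE.
  by rewrite divfK// gt_eqF.
rewrite -sumrB.
apply: (@le_trans _ _ (\sum_(j < N) (e / 2 / a * kernel n (t - j%:R / N%:R) +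
   C / a * (kernel n (t - j%:R / N%:R) - kernel n.+1 (t - j%:R / N%:R))))).
  apply: le_trans (ler_norm_sum _ _ _) _; apply: ler_sum => j _.
  rewrite /GRing.scale/= -mulrBl -mulrBl.
  set s := j%:R / N%:R.
  have s01 : s \in `[0, 1].
    by rewrite in_itv/= divr_ge0//= ler_pdivrMr// mul1r ler_nat ltnW.
  have := fC s t s01 t01.
  rewrite 2!normrM (ger0_norm (kernel_ge0 _ _)) normfV (gtr0_norm a0) => ft.
  have -> : kernel n.+1 (t - s) =
      kernel n (t - s) * (1 - sin (pi * (t - s)) ^+ 2).
    by rewrite /kernel doubleS -addn2 exprD cos2sin2.
  apply: (@le_trans _ _
    ((e / 2 + C * sin (pi * (t - s)) ^+ 2) / a * kernel n (t - s))).
    by rewrite ler_wpM2r// ler_wpM2r// invr_ge0 ltW.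
  by rewrite le_eqVlt; apply/orP; left; apply/eqP; ring.
rewrite big_split/= -2!big_distrr/= sumrB.
rewrite -[\sum_(_ < _) kernel n _]/(node_sum N (kernel n) t).
rewrite -[\sum_(_ < _) kernel n.+1 _]/(node_sum N (kernel n.+1) t).
have := @node_sum_kernelS R N n t (leqnn _); rewrite aE => rec.
have kS : node_sum N (kernel n.+1) t = a - a / n.+1.*2%:R.
  have n0 : n.+1.*2%:R != 0 :> R by rewrite pnatr_eq0.
  apply: (mulfI n0); rewrite rec mulrBr mulrCA divff// mulr1.
  by rewrite doubleS -[in RHS]natr1; ring.
have aN0 : a != 0 by exact: lt0r_neq0.
rewrite kS subKr divfK// [C / a * _]mulrA divfK//.
rewrite [leRHS]splitr lerD2l.
have : C / e < n.+1%:R by rewrite (lt_trans (truncnS_gt _))// ltr_nat.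
rewrite ltr_pdivrMr// => Cn.
by rewrite ler_pdivrMr ?ltr0n// -muln2 natrM; lra.
Qed.

End TrigonometricApproximation.

(** * The p-norm over the unit interval *)

Section UnitIntervalNorm.
Variables (R : realType) (r : R).
Hypothesis r1 : 1 <= r.
Implicit Types (u v w : R -> R) (e B : R).

Let I : set R := `]0, 1[.
Let mu := @lebesgue_measure R.

Definition Lp_norm u : \bar R := ('N[mu]_(r%:E)[(EFin \o u) \_ I])%E.

Let Jint u : \bar R := (\int[mu]_(x in I) (`|u x| `^ r)%:E)%E.

Let r0 : 0 < r. Proof. exact: lt_le_trans r1. Qed.
Let rN0 : r != 0. Proof. exact: lt0r_neq0. Qed.
Let mI : measurable I. Proof. exact: measurable_itv. Qed.
Let muI : mu I = 1%E.
Proof. by rewrite /mu lebesgue_measure_itv/= lte_fin ltr01 oppr0 adde0. Qed.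

Let Lp_normX u : (Lp_norm u `^ r = Jint u)%E.
Proof.
rewrite /Lp_norm poweR_Lnorm// /Jint [RHS]integral_mkcond.
apply: eq_integral => x _; rewrite !patchE; case: ifPn => //= _.
by rewrite normr0 powR0.
Qed.

Lemma Lp_norm_ge0 u : (0 <= Lp_norm u)%E.
Proof. exact: Lnorm_ge0. Qed.

Let Jint_ge0 u : (0 <= Jint u)%E.
Proof. by apply: integral_ge0 => x _; rewrite lee_fin powR_ge0. Qed.

Let Lp_normE u : Lp_norm u = (Jint u `^ r^-1)%E.
Proof. by rewrite -Lp_normX -poweRrM mulfV// poweRe1// Lp_norm_ge0. Qed.

Let Lp_norm_le u e : 0 <= e -> (Jint u <= (e `^ r)%:E)%E -> (Lp_norm u <= e%:E)%E.
Proof.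
move=> e0 Ju; rewrite Lp_normE.
have -> : e%:E = ((e `^ r)%:E `^ r^-1)%E.
  by rewrite -poweR_EFin -poweRrM mulfV// poweRe1.
apply: gt0_ler_poweR => //; first by rewrite invr_ge0 ltW.
  by rewrite in_itv/= Jint_ge0 leey.
by rewrite in_itv/= lee_fin powR_ge0 leey.
Qed.

Let measurable_pow u : measurable_fun I u ->
  measurable_fun I (EFin \o (fun x => `|u x| `^ r)).
Proof.
move=> mf; apply/measurable_EFinP.
apply: (@measurableT_comp _ _ _ _ _ _ (fun x : R => x `^ r)).
  exact: measurable_powR.
exact: measurableT_comp.
Qed.

Lemma le_Lp_norm u v : measurable_fun I u -> measurable_fun I v ->
  (forall x, I x -> `|u x| <= `|v x|) -> (Lp_norm u <= Lp_norm v)%E.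
Proof.
move=> mfu mfv uv; rewrite !Lp_normE; apply: gt0_ler_poweR.
- by rewrite invr_ge0 ltW.
- by rewrite in_itv/= Jint_ge0 leey.
- by rewrite in_itv/= Jint_ge0 leey.
apply: ge0_le_integral => //.
- exact: measurable_pow.
- exact: measurable_pow.
- by move=> x Ix; rewrite lee_fin ge0_ler_powR ?nnegrE ?(ltW r0)// uv.
Qed.

Lemma Lp_norm_le_cst u e : 0 <= e -> measurable_fun I u ->
  (forall x, I x -> `|u x| <= e) -> (Lp_norm u <= e%:E)%E.
Proof.
move=> e0 mfu ue; apply: Lp_norm_le => //.
rewrite -[leRHS]mule1 -muI -integral_cst//; apply: ge0_le_integral => //.
- exact: measurable_pow.
- by move=> x Ix; rewrite lee_fin ge0_ler_powR ?nnegrE ?(ltW r0)// ue.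
Qed.

Lemma Lp_normD u v : measurable_fun I u -> measurable_fun I v ->
  (Lp_norm (u \+ v)%R <= Lp_norm u + Lp_norm v)%E.
Proof.
move=> mfu mfv; rewrite /Lp_norm !restrict_EFin.
have -> : (u \+ v)%R \_ I = (u \_ I \+ v \_ I)%R.
  by apply/funext => x; rewrite /= !patchE; case: ifPn; rewrite ?addr0.
apply: minkowski_EFin => //; exact/(measurable_restrictT _ mI).
Qed.

(** For bounded functions, convergence in [L^1] implies convergence in [L^p],
    because [|w|^p <= B^(p-1) |w|].  The [+ 1] keeps the denominator positive
    when [B = 0]. *)
Lemma Lp_norm_le_L1 w B e : 0 <= B -> 0 < e -> measurable_fun I w ->
  (forall x, I x -> `|w x| <= B) ->
  (\int[mu]_(x in I) `|(w x)%:E| <= (e `^ r / (B `^ (r - 1) + 1))%:E)%E ->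
  (Lp_norm w <= e%:E)%E.
Proof.
move=> B0 e0 mfw wB le1; apply: Lp_norm_le; first exact: ltW.
have B1 : 0 < B `^ (r - 1) + 1 by rewrite ltr_wpDl// powR_ge0.
have mwabs : measurable_fun I (abse \o (EFin \o w)).
  by apply: measurableT_comp => //; exact/measurable_EFinP.
apply: (@le_trans _ _
  (\int[mu]_(x in I) ((B `^ (r - 1) + 1)%:E * `|(w x)%:E|))%E).
  apply: ge0_le_integral => //.
  - exact: measurable_pow.
  - exact: measurable_funeM.
  move=> x Ix; rewrite lee_fin.
  rewrite -(@mulr_powRB1 _ `|w x|)// mulrC.
  rewrite ler_wpM2r// (@le_trans _ _ (B `^ (r - 1)))//.
    by rewrite ge0_ler_powR ?nnegrE ?subr_ge0// wB.
  by rewrite lerDl.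
rewrite ge0_integralZl_EFin//; last exact: ltW.
by rewrite muleC -lee_pdivlMr//.
Qed.

(** Dominated convergence in [L^p], with the dominating function [u]. *)
Lemma Lp_norm_dominated (w_ : nat -> R -> R) u e : 0 < e ->
  (forall n, measurable_fun I (w_ n)) -> measurable_fun I u ->
  (forall n x, I x -> `|w_ n x| <= `|u x|) -> (Lp_norm u < +oo)%E ->
  (forall x, I x -> w_ n x @[n --> \oo] --> 0) ->
  exists n, (Lp_norm (w_ n) <= e%:E)%E.
Proof.
move=> e0 mfw mfu wu uoo w0.
have Ju : (Jint u < +oo)%E by rewrite -Lp_normX poweR_lty.
have iu : mu.-integrable I (fun x => (`|u x| `^ r)%:E).
  apply/integrableP; split; first exact: measurable_pow.
  rewrite (le_lt_trans _ Ju)// le_eqVlt; apply/orP; left; apply/eqP.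
  by apply: eq_integral => x _; rewrite gee0_abs// lee_fin powR_ge0.
have [] := @dominated_convergence _ _ _ mu I mI
  (fun n x => (`|w_ n x| `^ r)%:E) (cst 0%E) (fun x => (`|u x| `^ r)%:E).
- by move=> n; exact: measurable_pow.
- exact: measurable_cst.
- apply: aeW => x Ix; apply: cvg_EFin; first exact: nearW.
  apply/cvgr0Pnorm_le => d d0; near=> n => /=.
  rewrite ger0_norm ?powR_ge0//.
  have wd : `|w_ n x| <= d by near: n; exact: (cvgr0Pnorm_le _).1 (w0 _ Ix) _ d0.
  have w1 : `|w_ n x| <= 1 by near: n; exact: (cvgr0Pnorm_le _).1 (w0 _ Ix) _ ltr01.
  apply: le_trans wd.
  have [->|wN0] := eqVneq (w_ n x) 0; first by rewrite normr0 powR0.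
  by rewrite ge1r_powR// normr_gt0 wN0.
- exact: iu.
- apply: aeW => x n Ix; rewrite gee0_abs ?lee_fin ?powR_ge0//.
  by rewrite ge0_ler_powR ?nnegrE ?(ltW r0)// wu.
have JE n :
    (\int[mu]_(x in I) `|(`|w_ n x| `^ r)%:E - cst 0 x|)%E = Jint (w_ n).
  by apply: eq_integral => x _; rewrite /= subr0 ger0_norm// powR_ge0.
under eq_fun do rewrite JE.
move=> _ + _ => /fine_cvgP[finJ cvJ].
have er0 : 0 < e `^ r by rewrite powR_gt0.
have [n [fJ Jn]] :=
  filter_ex (filterI finJ ((cvgr0Pnorm_le _).1 cvJ _ er0)).
exists n; apply: Lp_norm_le; first exact: ltW.
by rewrite -[Jint (w_ n)](fineK fJ) lee_fin (le_trans (ler_norm _)).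
Unshelve. all: by end_near.
Qed.

End UnitIntervalNorm.

(** * From continuous to p-integrable functions *)

Section Truncation.
Variable R : realType.
Implicit Types (n x y : R).

(** The projection of [x] onto [[-n, n]], for [n >= 0]; this closed form makes
    continuity and the Lipschitz bound immediate. *)
Definition clip n x : R := (`|x + n| - `|x - n|) / 2.

Lemma continuous_clip n : continuous (clip n).
Proof.
move=> x; apply: cvgMr_tmp; apply: cvgB; apply: cvg_norm.
  by apply: cvgD; [exact: cvg_id|exact: cvg_cst].
by apply: cvgB; [exact: cvg_id|exact: cvg_cst].
Qed.

Lemma clip_id n x : `|x| <= n -> clip n x = x.
Proof.
rewrite ler_norml => /andP[nx xn]; rewrite /clip ger0_norm; last by lra.
by rewrite ler0_norm; [field|lra].
Qed.

Lemma norm_clip n x : 0 <= n -> `|clip n x| <= n.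
Proof.
move=> n0; rewrite ler_norml /clip.
by case: (ger0P (x + n)); case: (ger0P (x - n)) => ? ?; apply/andP; split; lra.
Qed.

Lemma norm_sub_clip n x : 0 <= n -> `|x - clip n x| <= `|x|.
Proof.
move=> n0; rewrite /clip.
case: (ger0P (x + n)); case: (ger0P (x - n)) => ? ?;
  rewrite ler_norml; case: (ger0P x) => ?; apply/andP; split; lra.
Qed.

Lemma clip_lipschitz n x y : `|clip n x - clip n y| <= `|x - y|.
Proof.
have a : `| `|x + n| - `|y + n| | <= `|x - y|.
  by rewrite (le_trans (ler_dist_dist _ _))// opprD addrACA subrr addr0.
have b : `| `|x - n| - `|y - n| | <= `|x - y|.
  by rewrite (le_trans (ler_dist_dist _ _))// opprB addrA subrK.
move: a b; rewrite /clip !ler_norml => /andP[? ?] /andP[? ?].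
by apply/andP; split; lra.
Qed.

End Truncation.

Section LpDensity.
Variables (R : realType) (r : R).
Hypothesis r1 : 1 <= r.
Variable S : set (R -> R).
Let I : set R := `]0, 1[.
Let mu := @lebesgue_measure R.
Hypothesis mS : forall g, S g -> measurable_fun I g.
Hypothesis denseS : forall f : R -> R, continuous f -> f 0 = f 1 ->
  unif_closure `[0, 1] S f.

Let mI : measurable I. Proof. exact: measurable_itv. Qed.

Let muI : mu I = 1%E.
Proof. by rewrite /mu lebesgue_measure_itv/= lte_fin ltr01 oppr0 adde0. Qed.

Let continuous_mfun (f : R -> R) : continuous f -> measurable_fun I f.
Proof.
by move=> cf; apply: measurable_funTS; exact: continuous_measurable_fun.
Qed.

Let approx_truncation (u : R -> R) (e : R) : 0 < e -> measurable_fun I u ->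
  (Lp_norm r u < +oo)%E ->
  exists2 n : nat, measurable_fun I (clip n%:R \o u) &
    (Lp_norm r (u \- (clip n%:R \o u))%R <= e%:E)%E.
Proof.
move=> e0 mfu uoo.
have mclip n : measurable_fun I (clip n%:R \o u).
  apply: measurableT_comp => //; apply: continuous_measurable_fun.
  exact: continuous_clip.
have [|||n hn] := @Lp_norm_dominated R r r1 (fun n => u \- (clip n%:R \o u))
  u e e0 _ mfu _ uoo _.
- by move=> n; exact: measurable_funB.
- by move=> n x _; exact: norm_sub_clip.
- move=> x _; apply: cvg_near_cst.
  exists (Num.truncn `|u x|).+1 => // n /= un; rewrite clip_id ?subrr//.
  by rewrite ltW// (lt_le_trans (truncnS_gt _))// ler_nat.
by exists n.
Qed.

(** Clipping an approximant of [u] in [L^1] does not increase the distance to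
    [u], since clipping is 1-Lipschitz and fixes the values of [u]. *)
Let approx_continuous (u : R -> R) (n e : R) : 0 < e -> 0 <= n ->
  measurable_fun I u -> (forall x, `|u x| <= n) ->
  exists g : R -> R, [/\ continuous g, forall x, `|g x| <= n &
    (Lp_norm r (u \- g)%R <= e%:E)%E].
Proof.
move=> e0 n0 mfu un.
have Ioo : (mu I < +oo)%E by rewrite muI ltry.
have iu : mu.-integrable I (EFin \o u).
  apply: measurable_bounded_integrable => //.
  exists n; split; rewrite ?num_real// => M nM x _ /=.
  by rewrite (le_trans (un x))// ltW.
have [g [cg _ /fine_cvgP[fing cvg]]] :=
  approximation_continuous_integrable mI Ioo iu.
pose eta := e `^ r / ((n + n) `^ (r - 1) + 1).
have eta0 : 0 < eta.
  by rewrite divr_gt0 ?powR_gt0// ltr_wpDl// powR_ge0.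
have [k [fk gk]] :=
  filter_ex (filterI fing ((cvgr0Pnorm_le _).1 cvg _ eta0)).
have mug : measurable_fun I (u \- (clip n \o g k)).
  apply: measurable_funB => //; apply: continuous_mfun => x.
  by apply: continuous_comp; [exact: cg|exact: continuous_clip].
exists (clip n \o g k); split.
- by move=> x; apply: continuous_comp; [exact: cg|exact: continuous_clip].
- by move=> x; exact: norm_clip.
apply: (@Lp_norm_le_L1 R r r1 _ (n + n)) => //; first by rewrite addr_ge0.
  by move=> x _; rewrite (le_trans (ler_normB _ _))// lerD// norm_clip.
apply: (@le_trans _ _ (\int[mu]_(x in I) `|(u x - g k x)%:E|)%E).
  apply: ge0_le_integral => //.
  - by apply: measurableT_comp => //; exact/measurable_EFinP.
  - apply: measurableT_comp => //; apply/measurable_EFinP.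
    by apply: measurable_funB => //; exact: continuous_mfun.
  - by move=> x _; rewrite lee_fin /= -{1}(clip_id (un x)) clip_lipschitz.
by rewrite -(fineK fk) lee_fin (le_trans (ler_norm _)).
Qed.

(** The cutoff [1 - (2 x - 1)^(2 k)] vanishes at 0 and 1 and tends to 1 on the
    open interval as [k] grows. *)
Let approx_periodic (g : R -> R) (n e : R) : 0 < e -> 0 <= n ->
  continuous g -> (forall x, `|g x| <= n) ->
  exists f : R -> R, [/\ continuous f, f 0 = f 1 &
    (Lp_norm r (g \- f)%R <= e%:E)%E].
Proof.
move=> e0 n0 cg gn.
pose chi (k : nat) (x : R) := (2 * x - 1) ^+ 2 ^+ k.
have cchi k : continuous (chi k).
  have -> : chi k = horner (((2 *: 'X - 1) ^+ 2) ^+ k).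
    by apply/funext => x; rewrite !hornerE.
  exact: continuous_horner.
have q01 x : I x -> 0 <= (2 * x - 1) ^+ 2 < 1.
  by rewrite /I/= in_itv/= => /andP[? ?]; rewrite sqr_ge0/=; nra.
have [|||||k hk] := @Lp_norm_dominated R r r1 (fun k => g \* chi k) (cst n)
  e e0 _ _ _ _ _.
- by move=> k; apply: measurable_funM; exact: continuous_mfun.
- exact: measurable_cst.
- move=> k x /q01/andP[q0 q1] /=.
  rewrite normrM [leRHS]ger0_norm// -[leRHS]mulr1.
  apply: ler_pM => //; rewrite /chi (ger0_norm (exprn_ge0 _ q0)).
  exact: exprn_ile1 q0 (ltW q1).
- apply: le_lt_trans (Lp_norm_le_cst r1 n0 _ _) (ltry _) => // x _.
  by rewrite ger0_norm.
- move=> x /q01/andP[q0 q1]; rewrite -[0](mulr0 (g x)); apply: cvgMl_tmp.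
  by apply: cvg_expr; rewrite ger0_norm.
exists (fun x => g x - g x * chi k x); split.
- move=> x; apply: cvgB; first exact: cg.
  by apply: cvgM; [exact: cg|exact: cchi].
- have chi0 : chi k 0 = 1 by rewrite /chi mulr0 sub0r sqrrN !expr1n.
  have chi1 : chi k 1 = 1 by rewrite /chi mulr1 addrK !expr1n.
  by rewrite chi0 chi1 !mulr1 !subrr.
- by rewrite (_ : _ \- _ = g \* chi k)//; apply/funext => x /=; ring.
Qed.

(** Truncation, regularization, cutoff and uniform approximation each cost at
    most [e / 5]. *)
Lemma Lp_dense (u : R -> R) (e : R) : 0 < e -> measurable_fun I u ->
  (Lp_norm r u < +oo)%E ->
  exists h, [/\ lspan S h, measurable_fun I h &
    (Lp_norm r (u \- h)%R < e%:E)%E].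
Proof.
move=> e0 mfu uoo; pose d := e / 5; have d0 : 0 < d by rewrite divr_gt0.
have [n mu1 hu1] := approx_truncation d0 mfu uoo.
set u1 := clip n%:R \o u in mu1 hu1.
have [|g [cg gn hg]] := @approx_continuous u1 n%:R d d0 (ler0n _ _) mu1.
  by move=> x; exact: norm_clip.
have [f [cf f01 hf]] := approx_periodic d0 (ler0n _ n) cg gn.
have [h Sh fh] := denseS cf f01 d0.
have mfh : measurable_fun I h.
  elim: Sh {fh} => [|a x y Sx _ IH]; first exact: measurable_cst.
  by apply: measurable_funD => //; apply: measurable_funM => //; exact: mS.
exists h; split => //.
have mg := continuous_mfun cg; have mf := continuous_mfun cf.
have hh : (Lp_norm r (f \- h)%R <= d%:E)%E.
  apply: Lp_norm_le_cst => //; [exact: ltW|exact: measurable_funB|].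
  by move=> x /subset_itv_oo_cc; exact: fh.
have -> : u \- h = (((u \- u1) \+ (u1 \- g)) \+ (g \- f)) \+ (f \- h).
  by apply/funext => x /=; ring.
have m1 : measurable_fun I (u \- u1) by exact: measurable_funB.
have m2 : measurable_fun I (u1 \- g) by exact: measurable_funB.
have m3 : measurable_fun I (g \- f) by exact: measurable_funB.
have m4 : measurable_fun I (f \- h) by exact: measurable_funB.
have m12 := measurable_funD m1 m2.
have m123 := measurable_funD m12 m3.
apply: (@le_lt_trans _ _ (d + d + d + d)%:E); last by rewrite lte_fin /d; lra.
rewrite !EFinD.
by do 3 (apply: (le_trans (Lp_normD r1 _ _)) => //; rewrite leeD//).
Qed.

End LpDensity.

(** * Complex coefficients and totality *)

Section ComplexSpan.
Variable R : realType.
Implicit Types (S : set (R -> R)) (SC : set (R -> R[i])).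
Local Open Scope complex_scope.

Lemma linear_span_cons SC (c : R[i]) g k : SC g -> linear_span SC k ->
  linear_span SC (fun t => c * g t + k t).
Proof.
move=> Sg [n [d [h [Sh ->]]]].
exists n.+1, (fun i => oapp d c (unlift ord0 i)),
  (fun i => oapp h g (unlift ord0 i)).
split=> [i|]; first by case: unliftP => [j|] _ //=; exact: Sh.
apply/funext => t; rewrite big_ord_recl unlift_none/=; congr (_ + _).
by apply: eq_bigr => i _; rewrite liftK.
Qed.

Lemma lspan_linear_span S SC (c : R[i]) u k :
  (forall v, S v -> SC (fun t => (v t)%:C)) ->
  lspan S u -> linear_span SC k -> linear_span SC (fun t => c * (u t)%:C + k t).
Proof.
move=> SSC Su; elim: Su c k => [|a x y Sx _ IH] c k hk.
  rewrite (_ : (fun t => _) = k)//; apply/funext => t.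
  by have -> : ((0 : R -> R) t)%:C = 0 by []; rewrite mulr0 add0r.
rewrite (_ : (fun t => _) =
  (fun t => c * a%:C * (x t)%:C + (c * (y t)%:C + k t))).
  by apply: linear_span_cons; [exact: SSC|exact: IH].
by apply/funext => t; rewrite addrA -mulrA -mulrDr -rmorphM -rmorphD.
Qed.

Lemma linear_span_complex S SC (u v : R -> R) :
  (forall w, S w -> SC (fun t => (w t)%:C)) ->
  lspan S u -> lspan S v -> linear_span SC (fun t => u t +i* v t).
Proof.
move=> SSC Su Sv.
have h0 : linear_span SC (fun=> 0).
  exists 0%N, (fun=> 0), (fun=> fun=> 0); split => [[]//|].
  by apply/funext => t; rewrite big_ord0.
have := lspan_linear_span 1 SSC Su (lspan_linear_span 'i SSC Sv h0).
congr linear_span; apply/funext => t.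
by rewrite mul1r addr0; simpc.
Qed.

Lemma modulus_le_ReIm (z : R[i]) :
  Normc.normc z <= `|complex.Re z| + `|complex.Im z|.
Proof.
case: z => a b /=; rewrite -[leRHS]ger0_norm ?addr_ge0// -sqrtr_sqr.
apply: ler_wsqrtr; rewrite sqrrD !real_normK ?num_real// addrAC lerDl.
by rewrite mulrn_wge0// mulr_ge0.
Qed.

Lemma Re_le_modulus (z : R[i]) : `|complex.Re z| <= Normc.normc z.
Proof. by case: z => a b /=; rewrite -sqrtr_sqr ler_wsqrtr// lerDl sqr_ge0. Qed.

Lemma Im_le_modulus (z : R[i]) : `|complex.Im z| <= Normc.normc z.
Proof. by case: z => a b /=; rewrite -sqrtr_sqr ler_wsqrtr// lerDr sqr_ge0. Qed.

Lemma measurable_modulus (D : set R) (f : R -> R[i]) :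
  measurable_fun D (fun t => complex.Re (f t)) ->
  measurable_fun D (fun t => complex.Im (f t)) ->
  measurable_fun D (modulus f).
Proof.
move=> mRe mIm.
rewrite (_ : modulus f = fun t =>
    Num.sqrt (complex.Re (f t) ^+ 2 + complex.Im (f t) ^+ 2)); last first.
  by apply/funext => t; rewrite /modulus; case: (f t).
apply: (@measurableT_comp _ _ _ _ _ _ (@Num.sqrt R)).
  by apply: continuous_measurable_fun; exact: sqrt_continuous.
by apply: measurable_funD; exact: measurable_funX.
Qed.

Lemma periodic_frac (t : R) : exists2 s, s \in `[0, 1] &
  forall g : R -> R, periodic g 1 -> g t = g s.
Proof.
exists (t - (Num.floor t)%:~R).
  rewrite in_itv/= subr_ge0 floor_le_tmp/= lerBlDr addrC ltW//.
  by rewrite -[X in _ + X]/(1%:~R) -intrD floorD1_gt.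
move=> g pg; set m := Num.floor t.
case: m => n.
  by rewrite -[in LHS](subrK n%:R t) (periodicn pg).
by rewrite NegzE rmorphN opprK/= (periodicn pg).
Qed.

End ComplexSpan.

Section Totality.
Variable R : realType.
Local Open Scope complex_scope.
Let I : set R := `]0, 1[.

Lemma continuous_cos_pow (s : R) n : continuous (cos_pow s n).
Proof.
move=> t; apply: (@continuous_comp _ _ _
  (fun y => cos (2 * pi * (y - s))) (fun x => x ^+ n)); last first.
  exact: exprn_continuous.
apply: continuous_comp; last exact: continuous_cos.
by apply: cvgMl_tmp; apply: cvgB; [exact: cvg_id|exact: cvg_cst].
Qed.

Lemma periodic_cos_pow (s : R) n : periodic (cos_pow s n) 1.
Proof.
move=> t; rewrite /cos_pow -[in RHS](cosD2pi (2 * pi * (t - s))).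
by congr (cos _ ^+ n); rewrite mulr2n; ring.
Qed.

Lemma Xnorm_fin (r : R) (f : R -> R[i]) : Xnorm r%:E f = Lp_norm r (modulus f).
Proof. by []. Qed.

Lemma Xspace_cos_pow (p : \bar R) (s : R) n : (1 <= p)%E ->
  Xspace p (fun t => (cos_pow s n t)%:C).
Proof.
case: p => [r||]//; last first.
  move=> _; rewrite /Xspace eqxx; split => /=.
  - by move=> t; rewrite periodic_cos_pow.
  - exact: continuous_cos_pow.
  - by move=> t; exact: cvg_cst.
rewrite lee_fin => r1; rewrite /Xspace /=.
have m1 : measurable_fun I (cos_pow s n).
  apply: measurable_funTS; apply: continuous_measurable_fun.
  exact: continuous_cos_pow.
split; [exact: m1|exact: (measurable_cst (0 : R))|].
rewrite Xnorm_fin.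
apply: le_lt_trans (@Lp_norm_le_cst R r r1 _ 1 _ _ _) (ltry _) => //.
  by apply: measurable_modulus => //; exact: (measurable_cst (0 : R)).
move=> x _; rewrite /modulus /= expr0n addr0 sqrtr_sqr normr_id normrX exprn_ile1//.
exact: cos_max.
Qed.

(** Real and imaginary parts are approximated separately; the modulus of the
    error is at most the sum of the two errors.  For [p = +oo] uniform
    approximation on one period suffices, by periodicity. *)
Lemma totalX_of_unif_closure (S : set (R -> R)) (SC : set (R -> R[i]))
    (p : \bar R) :
  (1 <= p)%E -> SC `<=` Xspace p ->
  (forall w, S w -> SC (fun t => (w t)%:C)) ->
  (forall w, S w -> periodic w 1) -> (forall w, S w -> measurable_fun I w) ->
  (forall f : R -> R, continuous f -> f 0 = f 1 -> unif_closure `[0, 1] S f) ->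
  totalX p SC.
Proof.
move=> p1 SX SSC Sper mS dense; split => // f; case: p p1 SX => [r||]//; last first.
  move=> _ _; rewrite /Xspace eqxx => -[pf cRe cIm] e e0.
  pose d := e / 3; have d0 : 0 < d by rewrite divr_gt0.
  have pRe : periodic (fun t => complex.Re (f t)) 1 by move=> t /=; rewrite pf.
  have pIm : periodic (fun t => complex.Im (f t)) 1 by move=> t /=; rewrite pf.
  have e01 (g : R -> R) : periodic g 1 -> g 0 = g 1.
    by move=> pg; rewrite -[in RHS](add0r 1) pg.
  have [h1 Sh1 fh1] := dense _ cRe (e01 _ pRe) d d0.
  have [h2 Sh2 fh2] := dense _ cIm (e01 _ pIm) d d0.
  have perS u : lspan S u -> periodic u 1.
    elim=> [|a x y Sx _ IH] t; first by [].
    by rewrite !fctE IH (Sper _ Sx).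
  exists (fun t => h1 t +i* h2 t); first exact: linear_span_complex SSC Sh1 Sh2.
  rewrite /Xnorm eqxx; apply: (@le_lt_trans _ _ (d + d)%:E); last first.
    by rewrite lte_fin /d; lra.
  apply: ge_ereal_sup => _ [t _ <-]; rewrite lee_fin /modulus.
  have [s s01 ts] := periodic_frac t.
  have := fh1 s s01; have := fh2 s s01.
  rewrite -(ts _ pRe) -(ts _ pIm).
  rewrite -(ts _ (perS _ Sh1)) -(ts _ (perS _ Sh2)) => b2 b1.
  apply: le_trans (modulus_le_ReIm _) _.
  by apply: lerD; [move: b1|move: b2]; case: (f t).
rewrite lee_fin => r1 _; rewrite /Xspace /= => -[mRe mIm foo] e e0.
rewrite Xnorm_fin in foo.
have mf := measurable_modulus mRe mIm.
have norm_modulus (z : R[i]) : `|Normc.normc z| = Normc.normc z.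
  by rewrite ger0_norm//; case: z => a b; exact: sqrtr_ge0.
have Reoo : (Lp_norm r (fun t => complex.Re (f t)) < +oo)%E.
  apply: le_lt_trans foo; apply: le_Lp_norm => // x _.
  by rewrite norm_modulus Re_le_modulus.
have Imoo : (Lp_norm r (fun t => complex.Im (f t)) < +oo)%E.
  apply: le_lt_trans foo; apply: le_Lp_norm => // x _.
  by rewrite norm_modulus Im_le_modulus.
have e20 : 0 < e / 2 by rewrite divr_gt0.
have [h1 [Sh1 mh1 fh1]] := Lp_dense r1 mS dense e20 mRe Reoo.
have [h2 [Sh2 mh2 fh2]] := Lp_dense r1 mS dense e20 mIm Imoo.
exists (fun t => h1 t +i* h2 t); first exact: linear_span_complex SSC Sh1 Sh2.
rewrite Xnorm_fin.
set u1 := (fun t => _) \- h1 in fh1; set u2 := (fun t => _) \- h2 in fh2.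
have mu1 : measurable_fun I u1 by exact: measurable_funB.
have mu2 : measurable_fun I u2 by exact: measurable_funB.
have mn1 : measurable_fun I (Num.norm \o u1) by exact: measurableT_comp.
have mn2 : measurable_fun I (Num.norm \o u2) by exact: measurableT_comp.
have ReE t : complex.Re (f t - (h1 t +i* h2 t)) = u1 t.
  by rewrite /u1 /=; case: (f t).
have ImE t : complex.Im (f t - (h1 t +i* h2 t)) = u2 t.
  by rewrite /u2 /=; case: (f t).
apply: (@le_lt_trans _ _ (Lp_norm r ((Num.norm \o u1) \+ (Num.norm \o u2)))).
  apply: le_Lp_norm => //.
  - apply: measurable_modulus.
      by rewrite (_ : (fun t => _) = u1)//; apply/funext => t; exact: ReE.
    by rewrite (_ : (fun t => _) = u2)//; apply/funext => t; exact: ImE.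
  - exact: measurable_funD.
  move=> x _; rewrite norm_modulus [leRHS]ger0_norm; last by apply: addr_ge0 => /=.
  by rewrite (le_trans (modulus_le_ReIm _))// ReE ImE.
apply: (le_lt_trans (Lp_normD r1 mn1 mn2)).
rewrite [e]splitr EFinD; apply: lteD.
  by apply: le_lt_trans fh1; apply: le_Lp_norm => // x _; rewrite normr_id.
by apply: le_lt_trans fh2; apply: le_Lp_norm => // x _; rewrite normr_id.
Qed.

End Totality.

Theorem theorem4p6 (R : realType) (p : \bar R) (hp : (1 <= p)%E)
    (theta1 theta2 : R) (h1 : 0 <= theta1 < 1) (h2 : 0 <= theta2 < 1)
    (h12 : irrational (theta1 - theta2)) (L L' : set nat)
    (hL : Muntz_Szasz R L) (hL' : Muntz_Szasz R L') :
  totalX p (cos_powers theta1 L `|` cos_powers theta2 L').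
Proof.
apply: (@totalX_of_unif_closure R
  ([set cos_pow theta1 l | l in L] `|` [set cos_pow theta2 l | l in L'])) => //.
- by move=> _ [|] [l _ <-]; exact: Xspace_cos_pow.
- by move=> _ [|] [l Ll <-]; [left|right]; exists l.
- by move=> _ [|] [l _ <-]; exact: periodic_cos_pow.
- move=> _ [|] [l _ <-]; apply: measurable_funTS;
    by apply: continuous_measurable_fun; exact: continuous_cos_pow.
- move=> f cf f01; apply: unif_closure_trans (continuous_unif_closure cf f01).
  move=> _ [[s n] _ <-]; apply: (@unif_closure_subset _ _ _ setT) => //.
  exact: cos_pow_unif_closure.
Qed.
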